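(* Assume $\ell \geq 2$. The following statements are equivalent: (1) $K$ is a difference set of $\mathbb{F}_q$. (2) $k$ is odd and $\sum_{i=0}^{\ell-1} (i, j)^2 = \sum_{i=0}^{\ell-1} (i, q')^2$ for some $j$ with $\gcd(j, \ell) = 1$. (3) $k$ is odd and the main diagonal entries of $A^T A$ are of the form $(a, b, \ldots, b)$. In this case, $$A^T A = \lambda k J_{\ell} + (k-\lambda) I_{\ell} - k E_{0,0},$$ where $\lambda = \frac{k-1}{\ell}$. Moreover, if $B$ is the submatrix of $A$ obtained by removing the entries $\{(i,0),(q',j)\}_{0\le i,j\le \ell-1}$, i.e. by deleting the column indexed by $0$ and the row indexed by $q'$ (modulo $\ell$), then $$B^T B = (k - \lambda) (\lambda J_{\ell-1} + I_{\ell-1}).$$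
   Context: Let $q$ be a power of an odd prime, $\ell$ a divisor of $q-1$, $g$ a chosen generator (primitive root) of $\mathbb{F}_q^{*}$, $K$ the set of all $\ell$-th powers in $\mathbb{F}_q^*=\mathbb{F}_q\setminus\{0\}$, $k=|K|=\frac{q-1}{\ell}$, and $q' = \frac{q-1}{2}$. For integers $i,j$ the cyclotomic number is $(i,j) = \left| (1 + g^i K) \cap g^j K \right|$, which depends only on $i,j$ modulo $\ell$. The cyclotomic matrix is $A = [(i,j)]_{0\le i,j\le \ell-1}$, with rows and columns indexed by $0,\dots,\ell-1$. $K$ is a difference set of $\mathbb{F}_q$ if there is a positive integer $\mu$ such that every nonzero element of $\mathbb{F}_q$ can be expressed as a difference $x-y$ with $(x,y)\in K\times K$ in exactly $\mu$ ways. $J_n$ is the $n\times n$ all-one matrix, $I_n$ the $n\times n$ identity matrix, and $E_{0,0}$ the $\ell\times\ell$ matrix with a $1$ in the $(0,0)$-entry and zeros elsewhere.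
   Formalization: The equivalence of (1) with (2) and (3) is stated only for k > 1: when k = 1, K = {1} is not a difference set (μ must be positive), yet (2) and (3) hold. The equivalence of (2) and (3) and both matrix formulas are stated for all k. *)

(* Defs.v *)
From mathcomp Require Import all_boot all_order all_algebra all_field.

Set Implicit Arguments.
Unset Strict Implicit.
Unset Printing Implicit Defensive.

Import GRing.Theory.
Local Open Scope ring_scope.

Definition powers (F : finFieldType) (l : nat) : {set F} :=
  [set x ^+ l | x : F & x != 0].

Definition power_coset (F : finFieldType) (l : nat) (g : F) (i : int) : {set F} :=
  [set g ^ i * x | x in powers F l].

Definition cyclotomic_number (F : finFieldType) (l : nat) (g : F) (i j : int) : nat :=
  #|[set 1 + x | x in power_coset l g i] :&: power_coset l g j|.

(* The entries are cast to [rat] because the parameter (k - 1) / l in the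
   formulas about this matrix is an exact quotient. *)
Definition cyclotomic_matrix (F : finFieldType) (l : nat) (g : F) : 'M[rat]_l :=
  \matrix_(i < l, j < l) (cyclotomic_number l g (Posz i) (Posz j))%:R.

(* [mu] is required to be positive, so a singleton is not a difference set of a
   field. *)
Definition is_difference_set (F : finFieldType) (D : {set F}) : Prop :=
  exists2 mu : nat, (0 < mu)%N &
    forall d : F, d != 0 ->
      #|[set p : F * F | [&& p.1 \in D, p.2 \in D & p.1 - p.2 == d]]| = mu.

Definition half_order (F : finFieldType) : nat := (#|F|.-1 %/ 2)%N.

Definition zero_index (l : nat) (l_gt0 : (0 < l)%N) : 'I_l := Ordinal l_gt0.

Definition half_index (F : finFieldType) (l : nat) (l_gt0 : (0 < l)%N) : 'I_l :=
  Ordinal (ltn_pmod (half_order F) l_gt0).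

Definition reduced_cyclotomic_matrix (F : finFieldType) (l : nat) (g : F)
    (l_gt0 : (0 < l)%N) : 'M[rat]_l.-1 :=
  row' (half_index F l_gt0) (col' (zero_index l_gt0) (cyclotomic_matrix l g)).

(* Main.v *)
Require Import Defs.
From mathcomp Require Import all_boot all_order all_algebra all_field.
From mathcomp Require Import ring.

(* Let N d be the number of (x, y) in K x K with x - y = d, and M_{s,t} d the
   same for C_s x C_t, where C_i = g ^ i K. Then
     k * (\sum_i (i, s)(i, t) + k [s = t = 0]) = \sum_d N d * M_{s,t} d,
   which for s = t is an autocorrelation of N; the entry (q', j) is N (g ^ j)
   since g ^ q' = -1. All three conditions amount to k being odd and N being
   constant on nonzero elements (with a positive constant for a difference
   set), and then the identity evaluates A^T A. *)

Set Implicit Arguments.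
Unset Strict Implicit.
Unset Printing Implicit Defensive.

Import GRing.Theory Num.Theory.
Local Open Scope ring_scope.

(** * Parity under involutions and difference counts in a finite abelian group *)

(** Comparing the enumeration ranks of x and f x splits A into two parts that f exchanges; a tie
    would be a fixed point. *)
Lemma involution_card_even (T : finType) (f : T -> T) (A : {set T}) :
  involutive f -> (forall x, (f x \in A) = (x \in A)) ->
  (forall x, x \in A -> f x != x) -> ~~ odd #|A|.
Proof.
move=> fK fA f_free.
pose up x := (enum_rank x < enum_rank (f x))%N.
have downE : #|A :\: [set x | up x]| = #|A :&: [set x | up x]|.
  rewrite -(card_imset _ (inv_inj fK)); apply: eq_card => y.
  apply/imsetP/idP => [[x xA ->]|yA].
    move: xA; rewrite !inE fA /up fK -leqNgt leq_eqVlt.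
    move=> /andP[/orP[/eqP eq_r|lt_r] xA].
      by have := f_free _ xA; rewrite (enum_rank_inj (val_inj eq_r)) eqxx.
    by rewrite xA.
  exists (f y); last by rewrite fK.
  by move: yA; rewrite !inE fA /up fK -leqNgt => /andP[-> /ltnW ->].
by rewrite -(cardsID [set x | up x] A) downE addnn odd_double.
Qed.

(** A pair (u, v) in S x T with u - v = d is recorded by v alone. The N and M_{s,t} of the overview
    are the cases S = T = K and S = C s, T = C t. *)
Definition difference_count (V : finZmodType) (S T : {set V}) (d : V) : nat :=
  #|[set v in T | v + d \in S]|.

Section DifferenceCount.

Variables (V : finZmodType) (S T : {set V}).

Lemma difference_countE d :
  difference_count S T d = (\sum_(v in T) (v + d \in S)%R)%N.
Proof.
rewrite /difference_count -sum1_card big_mkcond /= [RHS]big_mkcond /=.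
by apply: eq_bigr => v _; rewrite !inE; case: (v \in T) => //=; case: (_ \in S).
Qed.

Lemma difference_count0 : difference_count S T 0 = #|S :&: T|.
Proof. by apply: eq_card => v; rewrite !inE addr0 andbC. Qed.

Lemma sum_difference_count (f : V -> nat) :
  (\sum_d difference_count S T d * f d)%N =
  (\sum_(u in S) \sum_(v in T) f (u - v)%R)%N.
Proof.
under eq_bigr do rewrite difference_countE big_distrl /=.
rewrite exchange_big [RHS]exchange_big /=; apply: eq_bigr => v _.
rewrite (reindex_inj (addIr (- v))) [RHS]big_mkcond; apply: eq_bigr => u _ /=.
by rewrite addrCA subrr addr0; case: (u \in S); rewrite ?mul1n ?mul0n.
Qed.

Lemma card_difference_count :
  (\sum_d difference_count S T d)%N = (#|S| * #|T|)%N.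
Proof.
have := sum_difference_count (fun=> 1%N); under eq_bigr do rewrite muln1.
by move=> ->; rewrite sum_nat_const; rewrite sum1_card.
Qed.

Lemma difference_countN d : difference_count S T (- d) = difference_count T S d.
Proof.
rewrite /difference_count -(card_imset _ (addIr (- d))); apply: eq_card => y.
apply/imsetP/idP => [[x]|]; rewrite !inE.
  by move=> /andP[xT xS] ->; rewrite subrK xS.
by move=> /andP[yS yT]; exists (y + d); rewrite ?inE addrK ?yT.
Qed.

End DifferenceCount.

(** Multiplying both members of a pair by e multiplies their difference by e. It serves with e in K
    for invariance under K, and with e = g ^ s to compare M_{s,s} with N. *)
Lemma difference_count_scale (F : finFieldType) (S T S' T' : {set F}) (e d : F) :
  e != 0 -> (forall y, (e * y \in S') = (y \in S)) ->
  (forall y, (e * y \in T') = (y \in T)) ->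
  difference_count S' T' (e * d) = difference_count S T d.
Proof.
move=> e0 eS eT; rewrite /difference_count -[RHS](card_imset _ (mulfI e0)).
apply: eq_card => y; rewrite -[y](mulVKf e0) mem_imset; last exact: mulfI.
by rewrite !inE -mulrDr eS eT.
Qed.

Lemma sum_eq_mem (T : finType) (A : {set T}) c :
  (\sum_(w in A) (w == c))%N = (c \in A).
Proof.
rewrite big_mkcond (bigD1 c) //= eqxx big1 => [|w /negbTE->].
  by rewrite addn0; case: (c \in A).
by rewrite if_same.
Qed.

(** * The group K of l-th powers and the sets stable under it *)

Section Cyclotomy.

Variables (F : finFieldType) (l : nat) (g : F).
Local Notation K := (powers F l).
Local Notation C := (power_coset l g).
Local Notation N := (difference_count K K).

Lemma mem_powers0 x : x \in K -> x != 0.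
Proof. by case/imsetP=> y; rewrite inE => y0 ->; rewrite expf_neq0. Qed.

Lemma powers1 : 1 \in K.
Proof. by apply/imsetP; exists 1; rewrite ?inE ?oner_eq0 // expr1n. Qed.

Lemma powersV x : x \in K -> x^-1 \in K.
Proof.
case/imsetP=> y; rewrite inE => y0 ->; apply/imsetP; exists y^-1.
  by rewrite inE invr_eq0.
by rewrite exprVn.
Qed.

Lemma powersM x y : x \in K -> y \in K -> x * y \in K.
Proof.
case/imsetP=> a; rewrite inE => a0 -> /imsetP[b]; rewrite inE => b0 ->.
by apply/imsetP; exists (a * b); rewrite ?inE ?mulf_neq0 ?exprMn.
Qed.

Lemma powersMl x y : x \in K -> (x * y \in K) = (y \in K).
Proof.
move=> xK; apply/idP/idP; last exact: powersM.
by move/(powersM (powersV xK)); rewrite mulKf ?mem_powers0.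
Qed.

Lemma powersMr x y : x \in K -> (y * x \in K) = (y \in K).
Proof. by move=> xK; rewrite mulrC powersMl. Qed.

Lemma powersVE x : (x^-1 \in K) = (x \in K).
Proof. by apply/idP/idP => /powersV; rewrite ?invrK. Qed.

Lemma card_powers_gt0 : (0 < #|K|)%N.
Proof. by apply/card_gt0P; exists 1; rewrite powers1. Qed.

Definition power_stable (S : {set F}) :=
  forall x y, x \in K -> (x * y \in S) = (y \in S).

Lemma difference_count_stable S T x d : power_stable S -> power_stable T ->
  x \in K -> difference_count S T (x * d) = difference_count S T d.
Proof.
move=> sS sT xK; apply: difference_count_scale (mem_powers0 xK) _ _ => y.
  exact: sS.
exact: sT.
Qed.

Lemma powers_stable : power_stable K.
Proof. by move=> x y xK; rewrite powersMl. Qed.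

Lemma sum_powers_reindex (S : {set F}) (f : F -> nat) x :
  power_stable S -> x \in K ->
  (\sum_(v in S) f v = \sum_(v in S) f (x * v)%R)%N.
Proof.
move=> sS xK; rewrite (reindex_inj (mulfI (mem_powers0 xK))) /=.
by apply: eq_bigl => v; rewrite sS.
Qed.

(** Each pair in K x K is (u, u w) with w in K, its difference is u (1 - w), and f does not see the
    factor u; so each w is counted once for every u in K. *)
Lemma sum_one_sub_powers (f : F -> nat) :
  (forall x d, x \in K -> f (x * d) = f d) ->
  (#|K| * \sum_(w in K) f (1 - w)%R)%N = (\sum_d N d * f d)%N.
Proof.
move=> fK; rewrite sum_difference_count -sum_nat_const; apply: eq_bigr => u uK.
rewrite [RHS](sum_powers_reindex _ powers_stable uK); apply: eq_bigr => w _.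
by rewrite -[u - _](_ : u * (1 - w) = _) ?fK // mulrBr mulr1.
Qed.

(** * Cyclotomic classes and their partition of the nonzero elements *)

Hypotheses (l_dvd : (l %| #|F|.-1)%N) (g_gen : (#|F|.-1).-primitive_root g).

Lemma generator_neq0 : g != 0.
Proof.
apply/eqP=> g0; have := prim_expr_order g_gen.
rewrite g0 expr0n; case: eqP => [e|_ /eqP]; last by rewrite eq_sym oner_eq0.
by have := prim_order_gt0 g_gen; rewrite e.
Qed.

Lemma generator_powz_neq0 (i : int) : g ^ i != 0.
Proof. by rewrite expfz_eq0 negb_and generator_neq0 orbT. Qed.

Lemma generatorP x : x != 0 -> exists a : nat, x = g ^+ a.
Proof.
move=> x0; have q_gt0 : (0 < #|F|)%N by apply/card_gt0P; exists x.
case: (prim_rootP g_gen (x := x)) => [|a ->]; last by exists a.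
by apply: (mulfI x0); rewrite mulr1 -exprS prednK // expf_card.
Qed.

(** An exponent of g is determined only modulo q - 1, but its class modulo l is well defined because
    l divides q - 1. *)
Lemma mem_powers_exp a : (g ^+ a \in K) = (l %| a)%N.
Proof.
apply/imsetP/idP => [[y]|/dvdnP[b ->]].
  rewrite inE => /generatorP[b ->] /eqP; rewrite -exprM (eq_prim_root_expr g_gen).
  by move/eqP=> e; rewrite /dvdn -(modn_dvdm _ l_dvd) e modn_dvdm // modnMl.
by exists (g ^+ b); rewrite ?inE ?expf_neq0 ?generator_neq0 // exprM.
Qed.

Lemma mem_powers_expz (i : int) : (g ^ i \in K) = (l %| i)%Z.
Proof.
rewrite dvdzE; case: i => n /=; first exact: mem_powers_exp.
by rewrite powersVE mem_powers_exp.
Qed.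

Lemma mem_coset (i : int) y : (y \in C i) = (y / g ^ i \in K).
Proof.
have gi0 := generator_powz_neq0 i.
apply/imsetP/idP => [[x xK ->]|yK]; first by rewrite mulrC mulKf.
by exists (y / g ^ i); rewrite // mulrC divfK.
Qed.

Lemma coset_stable i : power_stable (C i).
Proof. by move=> x y xK; rewrite !mem_coset -mulrA powersMl. Qed.

Lemma coset_eq (i j : int) : (l %| (i - j)%R)%Z -> C i = C j.
Proof.
move=> ij; apply/setP=> y; rewrite !mem_coset.
have -> : y / g ^ j = g ^ (i - j) * (y / g ^ i).
  rewrite expfzDr ?generator_neq0 // [RHS]mulrC mulrA.
  by rewrite divfK ?generator_powz_neq0 // invr_expz.
by rewrite [RHS]powersMl ?mem_powers_expz.
Qed.

Lemma card_coset i : #|C i| = #|K|.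
Proof. by rewrite card_imset //; apply/mulfI/generator_powz_neq0. Qed.

Lemma coset_neq0 i y : y \in C i -> y != 0.
Proof.
by rewrite mem_coset => /mem_powers0; rewrite mulf_eq0 negb_or => /andP[].
Qed.

Lemma card_cosetI s t :
  #|C s :&: C t| = (#|K| * (l %| (s - t)%R)%Z)%N.
Proof.
case: (boolP (l %| _)%Z) => [st|nst].
  by rewrite (coset_eq st) setIid card_coset muln1.
rewrite muln0; apply/eqP; rewrite cards_eq0 -subset0; apply/subsetP => y.
rewrite !inE => /andP[ys yt]; move: nst; rewrite -mem_powers_expz => /negP[].
have y0 := coset_neq0 ys; move: ys yt; rewrite !mem_coset -powersVE => ys yt.
have := powersM ys yt.
by rewrite invfM invrK mulrACA mulVf // mul1r invr_expz -expfzDr ?generator_neq0.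
Qed.

Lemma coset_partition (l_gt0 : (0 < l)%N) b :
  b != 0 -> exists j : 'I_l, forall i : 'I_l, (b \in C (Posz i)) = (i == j).
Proof.
case/generatorP=> a ->; exists (Ordinal (ltn_pmod a l_gt0)) => i.
rewrite mem_coset -[g ^+ a]/(g ^ Posz a) invr_expz -expfzDr ?generator_neq0 //.
rewrite mem_powers_expz -eqz_mod_dvd !modz_nat eqz_nat -val_eqE /=.
by rewrite (modn_small (ltn_ord i)) eq_sym.
Qed.

(** A nonzero b lies in exactly one class, so a single term survives and tests whether a is in the
    class of b; 0 lies in no class. *)
Lemma sum_coset_pair (l_gt0 : (0 < l)%N) a b :
  (\sum_(i < l) (a \in C (Posz i)) * (b \in C (Posz i)))%N =
  (b != 0) && (a / b \in K).
Proof.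
case: eqP => [->|/eqP b0] /=.
  rewrite big1 // => i _; case: (boolP (0 \in _)) => [/coset_neq0|_].
    by rewrite eqxx.
  by rewrite muln0.
have [j jP] := coset_partition l_gt0 b0.
rewrite (bigD1 j) //= jP eqxx muln1 big1 => [|i /negbTE ij]; last first.
  by rewrite jP ij muln0.
rewrite addn0 mem_coset; congr nat_of_bool.
have bj : b / g ^ Posz j \in K by rewrite -mem_coset jP.
rewrite -[LHS](powersMr _ (powersV bj)) invfM invrK mulrACA.
by rewrite mulVf ?generator_powz_neq0 ?mulr1.
Qed.

(** * Cyclotomic numbers and sums of their products *)

Lemma cyclotomic_numberE i j :
  cyclotomic_number l g i j = (\sum_(y in C j) (y - 1 \in C i)%R)%N.
Proof.
rewrite /cyclotomic_number setIC -sum1_card big_mkcond [RHS]big_mkcond /=.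
apply: eq_bigr => y _; rewrite inE; case: (y \in C j) => //=.
have -> : (y \in [set 1 + x | x in C i]) = (y - 1 \in C i).
  by rewrite -{1}[y](addrNK 1) addrC mem_imset //; apply: addrI.
by case: (_ \in _).
Qed.

(* The pairs (u, v) in C s x C t with u - 1 and v - 1 in the same class are
   parametrised by w = (u - 1) / (v - 1) in K, and u - w v = 1 - w. *)
Lemma sum_cyclotomic_mul (l_gt0 : (0 < l)%N) (s t : int) :
  (\sum_(i < l)
       cyclotomic_number l g (Posz i) s * cyclotomic_number l g (Posz i) t
     + #|K| * ((1%R \in C s) && (1%R \in C t)))%N =
  (\sum_(w in K) difference_count (C s) (C t) (1 - w)%R)%N.
Proof.
(* The case v = 1 is split off: there w is not determined by (u, v), every w gives u = 1, and this
   produces the correction term with factor [#|K|]. *)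
transitivity (\sum_(w in K)
   (\sum_(v in C t) ((v != 1%R) && (w * (v - 1) + 1 \in C s)%R)
    + \sum_(v in C t) ((v == 1%R) && (w * (v - 1) + 1 \in C s)%R)))%N; last first.
  apply: eq_bigr => w wK; rewrite -big_split difference_countE.
  (* Replacing v by w v turns v + (1 - w) into w (v - 1) + 1. *)
  rewrite [RHS](sum_powers_reindex _ (coset_stable t) wK); apply: eq_bigr => v _.
  rewrite mulrBr mulr1 -addrA [- w + 1]addrC.
  by case: (v == 1); rewrite /= ?addn0.
rewrite big_split; congr (_ + _)%N; last first.
  rewrite -sum_nat_const; apply: eq_bigr => w wK.
  transitivity (\sum_(v in C t) (1%R \in C s) * (v == 1%R))%N.
    by rewrite -big_distrr sum_eq_mem /= mulnb.
  apply: eq_bigr => v _; case: eqP => [->|_]; last by rewrite muln0.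
  by rewrite subrr mulr0 add0r muln1.
under [LHS]eq_bigr => i _ do rewrite !cyclotomic_numberE big_distrlr /=.
rewrite exchange_big /=.
transitivity (\sum_(u in C s) \sum_(v in C t) \sum_(w in K)
    (v != 1%R) * (u == w * (v - 1) + 1)%R)%N.
  apply: eq_bigr => u _; rewrite exchange_big /=; apply: eq_bigr => v _.
  rewrite sum_coset_pair // subr_eq0; case: eqP => [_|/eqP v1] /=.
    by rewrite big1 // => w _; rewrite mul0n.
  have v10 : v - 1 != 0 by rewrite subr_eq0.
  rewrite -sum_eq_mem; apply: eq_bigr => w _; rewrite mul1n; congr nat_of_bool.
  by rewrite -subr_eq -[LHS](inj_eq (mulIf v10)) divfK // eq_sym.
under eq_bigr do rewrite exchange_big /=.
rewrite exchange_big /=; apply: eq_bigr => w _.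
rewrite exchange_big /=; apply: eq_bigr => v _.
by rewrite -big_distrr /= sum_eq_mem mulnb.
Qed.

Lemma card_powers (l_gt0 : (0 < l)%N) : (l * #|K|)%N = #|F|.-1.
Proof.
transitivity (\sum_(i < l) \sum_b (b \in C (Posz i)))%N.
  rewrite -{1}[l]card_ord -sum_nat_const; apply: eq_bigr => i _.
  by rewrite -(card_coset i) -sum1_card big_mkcond.
rewrite exchange_big /= (bigD1 0) //= big1 => [|i _]; last first.
  by case: (boolP (0 \in _)) => // /coset_neq0; rewrite eqxx.
rewrite add0n (eq_bigr (fun=> 1%N)) => [|b b0].
  by rewrite sum_nat_const muln1 -(cardC1 (0 : F)).
have [j jP] := coset_partition l_gt0 b0.
by rewrite (bigD1 j) //= jP eqxx big1 // => i /negbTE ij; rewrite jP ij.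
Qed.

(** M_{s,t} is invariant under K, so [sum_one_sub_powers] trades the differences 1 - w for all
    differences d, weighted by N. *)
Lemma cyclotomic_mul_difference (l_gt0 : (0 < l)%N) (s t : int) :
  (#|K| * (\sum_(i < l)
       cyclotomic_number l g (Posz i) s * cyclotomic_number l g (Posz i) t
     + #|K| * ((1%R \in C s) && (1%R \in C t))))%N =
  (\sum_d N d * difference_count (C s) (C t) d)%N.
Proof.
rewrite sum_cyclotomic_mul //; apply: (sum_one_sub_powers (f := difference_count _ _)).
by move=> x d xK; rewrite difference_count_stable //; apply: coset_stable.
Qed.

Lemma mem1_coset s : (1 \in C s) = (l %| s)%Z.
Proof. by rewrite mem_coset mul1r powersVE mem_powers_expz. Qed.

(** With N 0 = k and N = n elsewhere, the sum of N d * M_{s,t} d is k M_{s,t} 0 + n (k ^ 2 - M_{s,t}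
    0), where M_{s,t} 0 is k or 0; then k cancels. Negative terms are moved to the left to stay in
    [nat]. *)
Lemma sum_cyclotomic_mul_const (l_gt0 : (0 < l)%N) n (s t : int) :
  (forall d, d != 0 -> N d = n) ->
  (\sum_(i < l)
       cyclotomic_number l g (Posz i) s * cyclotomic_number l g (Posz i) t
     + #|K| * ((l %| s)%Z && (l %| t)%Z) + n * (l %| (s - t)%R)%Z)%N =
  (#|K| * (l %| (s - t)%R)%Z + n * #|K|)%N.
Proof.
move=> Nn; have k_gt0 := card_powers_gt0.
apply/eqP; rewrite -(eqn_pmul2l k_gt0); apply/eqP.
rewrite -(mem1_coset s) -(mem1_coset t) mulnDr cyclotomic_mul_difference //.
have := card_difference_count (C s) (C t).
rewrite !card_coset (bigD1 0) //=.
rewrite [X in (X + _)%N = _ -> _]difference_count0 card_cosetI => eqk.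
rewrite (bigD1 0) //= !difference_count0 setIid card_cosetI.
rewrite (eq_bigr (fun d => n * difference_count (C s) (C t) d)%N); last first.
  by move=> d d0; rewrite Nn.
rewrite -big_distrr /= mulnDr -addnA; congr (_ + _)%N.
by rewrite [RHS]mulnCA -eqk mulnDr addnC mulnCA.
Qed.

(** Counting K x K by differences gives k ^ 2 = k + n (q - 1) = k + n l k. Hence n is the parameter
    lambda. *)
Lemma difference_const_card (l_gt0 : (0 < l)%N) n :
  (forall d, d != 0 -> N d = n) -> (n * l).+1%N = #|K|.
Proof.
move=> Nn; apply/eqP; rewrite -(eqn_pmul2l card_powers_gt0); apply/eqP.
rewrite -card_difference_count (bigD1 0) //= difference_count0 setIid.
rewrite (eq_bigr (fun=> n)) => [|d d0]; last by rewrite Nn.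
rewrite sum_nat_const cardC1 -(card_powers l_gt0) mulnS; congr (_ + _)%N.
by rewrite mulnCA [RHS]mulnC [(l * _)%N]mulnC.
Qed.

(** * Odd q: the class of -1 and the parity of k *)

Hypothesis q_odd : odd #|F|.

Lemma half_orderK : (half_order F).*2 = #|F|.-1.
Proof.
rewrite /half_order divn2 -[RHS]odd_double_half.
suff /negbTE -> : ~~ odd #|F|.-1 by [].
by case: #|F| q_odd.
Qed.

Lemma generator_half : g ^+ half_order F = -1.
Proof.
have q1_gt0 := prim_order_gt0 g_gen.
have : (g ^+ half_order F) ^+ 2 == 1.
  by rewrite -exprM muln2 half_orderK prim_expr_order.
(* The root 1 is excluded because 0 < q' < q - 1. *)
rewrite sqrf_eq1 -(prim_order_dvd g_gen) => /orP[/dvdn_leq|/eqP//].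
move: q1_gt0; rewrite -half_orderK double_gt0 => h /(_ h).
by rewrite -addnn -[leqRHS]addn0 leq_add2l leqNgt h.
Qed.

Lemma two_neq0 : 1 + 1 != 0 :> F.
Proof.
apply/eqP => two0.
have m1 : -1 = 1 :> F by apply/esym/eqP; rewrite -subr_eq0 opprK two0.
have q1_gt0 := prim_order_gt0 g_gen.
have /eqP := generator_half; rewrite m1 -(prim_order_dvd g_gen) => /dvdn_leq.
move: q1_gt0; rewrite -half_orderK double_gt0 => h /(_ h).
by rewrite -addnn -[leqRHS]addn0 leq_add2l leqNgt h.
Qed.

(** This follows from 2 q' = q - 1 = l k. As g ^ q' = -1, the parity of k decides whether -1 is in
    K. *)
Lemma dvdn_half_order (l_gt0 : (0 < l)%N) : (l %| half_order F)%N = ~~ odd #|K|.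
Proof.
apply/idP/idP => [/dvdnP[m hm]|].
  have := card_powers l_gt0; rewrite -half_orderK hm -muln2 mulnAC mulnC => /eqP.
  by rewrite eqn_pmul2r // => /eqP->; rewrite muln2 odd_double.
move=> /even_halfK kE; have := card_powers l_gt0.
by rewrite -half_orderK -kE -doubleMr => /double_inj <-; rewrite dvdn_mulr.
Qed.

(** The class of g ^ q' is -K, so the entry counts the w in K with 1 - w in C j; k times this is the
    sum of N over C j, which is n k. *)
Lemma cyclotomic_half_row (l_gt0 : (0 < l)%N) n j :
  (forall d, d != 0 -> N d = n) ->
  cyclotomic_number l g (Posz (half_order F)) j = n.
Proof.
move=> Nn; apply/eqP; rewrite -(eqn_pmul2l card_powers_gt0); apply/eqP.
transitivity (#|K| * \sum_(w in K) (1 - w \in C j)%R)%N.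
  congr (_ * _)%N; rewrite cyclotomic_numberE big_mkcond [RHS]big_mkcond /=.
  rewrite (reindex_inj (subrI 1)) /=; apply: eq_bigr => w _.
  rewrite (mem_coset (Posz (half_order F))) [g ^ Posz (half_order F)]generator_half.
  rewrite invrN1 mulrN1 opprB subKr.
  by case: (_ \in _); case: (_ \in _).
rewrite (sum_one_sub_powers (f := fun d => d \in C j)) => [|x d xK]; last first.
  by rewrite coset_stable.
transitivity (\sum_(d in C j) n)%N; last by rewrite sum_nat_const card_coset.
rewrite [RHS]big_mkcond /=; apply: eq_bigr => d _.
case: (boolP (_ \in _)) => [/coset_neq0 d0|_].
  by rewrite Nn // muln1.
by rewrite muln0.
Qed.

(* If k is even then -1 is in K and x - y = d is preserved by
   (x, y) |-> (- y, - x), so N d is odd exactly when d / 2 is in K. *)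
Lemma difference_const_odd (l_ge2 : (2 <= l)%N) n :
  (forall d, d != 0 -> N d = n) -> odd #|K|.
Proof.
move=> Nn; apply: contraT => k_even; have g0 := generator_neq0.
have N1K : -1 \in K by rewrite -generator_half mem_powers_exp dvdn_half_order // ltnW.
have oppK x : (- x \in K) = (x \in K) by rewrite -mulN1r powersMl.
have gK : g \notin K by rewrite -[g]expr1 mem_powers_exp dvdn1; case: (l) l_ge2 => [|[]].
(* This is the symmetry (x, y) |-> (- y, - x) read on the second coordinate. For a difference d + d
   its only fixed point is - d, which avoids halving. *)
pose f (d v : F) := - d - v.
have fK d : involutive (f d) by move=> v; rewrite /f opprB opprK addrCA addNr addr0.
have fE d v : (f d v \in K) = (v + d \in K) by rewrite /f -opprD oppK addrC.
have fE' d v : (f d v + d \in K) = (v \in K) by rewrite /f addrAC addNr add0r oppK.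
have fix_f d v : f (d + d) v = v -> v = - d.
  move/eqP; rewrite /f subr_eq eq_sym => /eqP e; apply: (mulfI two_neq0).
  by rewrite !mulrDl !mul1r e opprD.
(* The possible fixed point - g is not in K, since l >= 2. *)
have evenNg : ~~ odd (N (g + g)).
  apply: (involution_card_even (fK (g + g))) => v; first by rewrite !inE fE fE' andbC.
  by rewrite !inE => /andP[vK _]; apply: contra gK => /eqP/fix_f e; rewrite -oppK -e.
(* Here the fixed point -1 does lie in the set; without it an even number remains. *)
have oddN1 : odd (N (1 + 1)).
  have N1A : -1 \in [set v in K | v + (1 + 1) \in K].
    by rewrite inE N1K addrA addNr add0r powers1.
  rewrite /difference_count (cardsD1 (-1)) N1A /=.
  apply: (involution_card_even (fK (1 + 1))) => v.
    rewrite !inE fE fE' [X in _ && X]andbC; congr (~~ _ && _).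
    by rewrite -(inj_eq (inv_inj (fK (1 + 1)))) fK /f opprK opprD addrNK.
  by rewrite !inE => /andP[vN1 _]; apply: contra vN1 => /eqP/fix_f ->.
move: evenNg; rewrite Nn; first by rewrite -(Nn _ two_neq0) oddN1.
by rewrite -[g]mul1r -mulrDl mulf_neq0 ?two_neq0.
Qed.

(** * From equal sums of squares to constant difference counts *)

Lemma periodic_expz (f : F -> nat) e : e != 0 -> (forall d, f (d * e) = f d) ->
  forall (m : int) d, f (d * e ^ m) = f d.
Proof.
move=> e0 fe m; have fn n d : f (d * e ^+ n) = f d.
  by elim: n d => [|n IHn] d; rewrite ?expr0 ?mulr1 // exprS mulrA IHn.
case: m => n d; first exact: fn.
by rewrite -[LHS](fn n.+1) -mulrA mulVf ?mulr1 ?expf_neq0.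
Qed.

(* Both sums of squares are autocorrelations of N, at the shifts j and q'; as
   N (- d) = N d, the second one is the autocorrelation at 0, and equality in
   Cauchy-Schwarz makes N invariant under multiplication by g ^ j. *)
Lemma sum_sqr_cyclotomic_const (l_ge2 : (2 <= l)%N) (j : int) :
  odd #|K| -> coprimez j l ->
  (\sum_(i < l) cyclotomic_number l g (Posz i) j ^ 2)%N =
  (\sum_(i < l) cyclotomic_number l g (Posz i) (Posz (half_order F)) ^ 2)%N ->
  forall d, d != 0 -> N d = N 1.
Proof.
move=> k_odd co_jl; have l_gt0 := ltnW l_ge2; have g0 := generator_neq0.
(* When l does not divide s the correction term vanishes, and scaling by g ^ s gives M_{s,s} d = N
   (d / g ^ s). *)
have autocorr s : ~~ (l %| s)%Z ->
    (#|K| * \sum_(i < l) cyclotomic_number l g (Posz i) s ^ 2)%N =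
    (\sum_d N d * N (d / g ^ s)%R)%N.
  move=> ls; have := cyclotomic_mul_difference l_gt0 s s.
  rewrite mem1_coset (negbTE ls) muln0 addn0 => ->; apply: eq_bigr => d _.
  congr (_ * _)%N; rewrite -{1}[d](divfK (generator_powz_neq0 s)) mulrC.
  by apply: difference_count_scale (generator_powz_neq0 s) _ _ => y;
    rewrite mem_coset mulrC mulKf ?generator_powz_neq0.
have lj : ~~ (l %| j)%Z.
  apply: contraL l_ge2 => lj; have : (l %| gcdz j l)%Z by rewrite dvdz_gcd lj dvdzz.
  by rewrite (eqP co_jl) dvdzE /= dvdn1 => /eqP->.
move/(congr1 (muln #|K|)); rewrite !autocorr //; last first.
  by rewrite dvdzE /= dvdn_half_order // negbK.
rewrite [g ^ Posz (half_order F)]generator_half invrN1.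
under [RHS]eq_bigr do rewrite mulrN1 difference_countN.
move=> eqS.
have gj0 := generator_powz_neq0 j; have gj0' : (g ^ j)^-1 != 0 by rewrite invr_eq0.
have eqS2 : (\sum_d N (d / g ^ j)%R * N (d / g ^ j)%R)%N = (\sum_d N d * N d)%N.
  by rewrite [RHS](reindex_inj (mulIf gj0')).
pose a d : rat := (N d)%:R; pose b d : rat := (N (d / g ^ j))%:R.
have Nj d : N (d / g ^ j) = N d.
  (* In the expansion, the two sums of squares and the cross sum all coincide by [eqS] and
     [eqS2]. *)
  have sum0 : \sum_d (a d - b d) ^+ 2 = 0.
    transitivity ((\sum_d N d * N d)%N%:R - (\sum_d N d * N (d / g ^ j)%R)%N%:R *+ 2
      + (\sum_d N (d / g ^ j)%R * N (d / g ^ j)%R)%N%:R : rat).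
      rewrite !natr_sum -sumrMnl -sumrB -big_split; apply: eq_bigr => e _ /=.
      by rewrite sqrrB !natrM !expr2.
    by rewrite eqS eqS2 mulr2n opprD addrA subrr add0r addNr.
  have /(_ d isT)/eqP := psumr_eq0P (fun e _ => sqr_ge0 (a e - b e)) sum0.
  by rewrite sqrf_eq0 subr_eq0 eqr_nat eq_sym => /eqP.
have Njm m d : N (d * (g ^ j) ^ m) = N d.
  apply: (periodic_expz (f := N)) => // e.
  by rewrite -[LHS]Nj mulfK.
have Nlm m d : N (d * (g ^ Posz l) ^ m) = N d.
  apply: (periodic_expz (f := N)) => [|e]; first exact: generator_powz_neq0.
  rewrite mulrC difference_count_stable //; try exact: powers_stable.
  by rewrite mem_powers_expz.
have Ng d : N (d * g) = N d.
  (* With u j + v l = 1, invariance under g ^ j and under g ^ l, an element of K, gives invariance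
     under g. *)
  have [u [v]] := Bezoutz j l; rewrite (eqP co_jl) => uv.
  rewrite -[X in d * X](expr1z g) -uv expfzDr // mulrA.
  by rewrite mulrC [u * j]mulrC [v * _]mulrC -!exprz_exp mulrC Nlm Njm.
move=> d /generatorP[e ->]; rewrite -[g ^+ e]mul1r.
exact: (periodic_expz (f := N) g0 Ng (Posz e)).
Qed.

(** * Difference sets and the Gram matrices of A and B *)

Lemma card_difference_pairs d :
  #|[set p : F * F | [&& p.1 \in K, p.2 \in K & p.1 - p.2 == d]]| = N d.
Proof.
have inj : injective (fun v : F => (v + d, v)) by move=> v w [].
rewrite /difference_count -(card_imset _ inj); apply: eq_card => -[x y].
rewrite inE /=; apply/and3P/imsetP => [[xK yK /eqP <-]|[v]].
  by exists y; rewrite ?inE ?yK /= addrC subrK.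
by rewrite inE => /andP[vK vdK] [-> ->]; rewrite vK vdK addrC addKr.
Qed.

Lemma difference_set_powersP :
  is_difference_set K <-> exists2 mu, (0 < mu)%N & forall d, d != 0 -> N d = mu.
Proof.
by split=> -[mu mu0 muE]; exists mu => // d /muE <-; rewrite card_difference_pairs.
Qed.

Lemma cyclotomic_number_eq (i i' j j' : int) :
  (l %| (i - i')%R)%Z -> (l %| (j - j')%R)%Z ->
  cyclotomic_number l g i j = cyclotomic_number l g i' j'.
Proof. by move=> ii jj; rewrite /cyclotomic_number (coset_eq ii) (coset_eq jj). Qed.

Lemma dvdz_subr_mod (m : nat) : (l %| (Posz (m %% l) - Posz m)%R)%Z.
Proof. by rewrite -eqz_mod_dvd !modz_nat modn_mod. Qed.

Lemma dvdz_subr_ord (i j : 'I_l) : (l %| (Posz i - Posz j)%R)%Z = (i == j).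
Proof. by rewrite -eqz_mod_dvd !modz_nat eqz_nat !modn_small. Qed.

Lemma dvdz_ord (l_gt0 : (0 < l)%N) (i : 'I_l) :
  (l %| Posz i)%Z = (i == zero_index l_gt0).
Proof. by rewrite -dvdz_subr_ord subr0. Qed.

Local Notation A := (cyclotomic_matrix l g).

Lemma cyclotomic_gramE (s t : 'I_l) :
  (A^T *m A) s t =
  (\sum_(i < l) cyclotomic_number l g (Posz i) (Posz s) *
     cyclotomic_number l g (Posz i) (Posz t))%N%:R.
Proof. by rewrite mxE natr_sum; apply: eq_bigr => i _; rewrite !mxE natrM. Qed.

Lemma cyclotomic_gram_diag (i : 'I_l) :
  (A^T *m A) i i =
  (\sum_(h < l) cyclotomic_number l g (Posz h) (Posz i) ^ 2)%N%:R.
Proof. by rewrite cyclotomic_gramE. Qed.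

Lemma half_index_neq0 (l_gt0 : (0 < l)%N) :
  odd #|K| -> half_index F l_gt0 != zero_index l_gt0.
Proof.
by move=> k_odd; have := dvdn_half_order l_gt0; rewrite k_odd -val_eqE /dvdn /= => ->.
Qed.

Section Constant.

Variable n : nat.
Hypotheses (l_gt0 : (0 < l)%N) (Nn : forall d, d != 0 -> N d = n).

Lemma cyclotomic_gram_const :
  A^T *m A = (n%:R * #|K|%:R) *: const_mx 1 + (#|K|%:R - n%:R) *: 1%:M
             - #|K|%:R *: delta_mx (zero_index l_gt0) (zero_index l_gt0).
Proof.
apply/matrixP=> s t; rewrite cyclotomic_gramE !mxE mulr1.
have /(congr1 (fun m => m%:R : rat)) :=
  sum_cyclotomic_mul_const l_gt0 (Posz s) (Posz t) Nn.
rewrite !dvdz_subr_ord !(dvdz_ord l_gt0) !natrD !natrM.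
by move=> /(canRL (addrK _))/(canRL (addrK _)) ->; ring.
Qed.

(** Row q' of A is constantly n, so deleting it subtracts n ^ 2 from each Gram entry; deleting
    column 0 discards the [delta_mx] term. Then n k - n ^ 2 = n (k - n). *)
Lemma reduced_cyclotomic_gram_const :
  (reduced_cyclotomic_matrix g l_gt0)^T *m
    reduced_cyclotomic_matrix g l_gt0 =
  (#|K|%:R - n%:R) *: (n%:R *: const_mx 1 + 1%:M).
Proof.
apply/matrixP=> s t.
pose s' := lift (zero_index l_gt0) s; pose t' := lift (zero_index l_gt0) t.
have An j : A (half_index F l_gt0) j = n%:R.
  rewrite mxE -(cyclotomic_half_row l_gt0 (Posz j) Nn); congr _%:R.
  by apply: cyclotomic_number_eq; rewrite ?subrr ?dvdz0 ?dvdz_subr_mod.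
have -> : ((reduced_cyclotomic_matrix g l_gt0)^T *m
    reduced_cyclotomic_matrix g l_gt0) s t = (A^T *m A) s' t' - n%:R * n%:R.
  apply: (canRL (addrK _)).
  rewrite addrC [RHS]mxE (bigD1_ord (half_index F l_gt0)) //=.
  rewrite [A^T s' _]mxE !An; congr (_ + _).
  by rewrite mxE; apply: eq_bigr => i _; rewrite !mxE.
rewrite cyclotomic_gram_const !mxE (inj_eq lift_inj) [s' == _]eq_sym.
by rewrite (negbTE (neq_lift _ _)) /=; ring.
Qed.

End Constant.

End Cyclotomy.

Theorem theorem1 (F : finFieldType) (l : nat) (g : F)
    (q_odd : odd #|F|)
    (l_dvd : (l %| #|F|.-1)%N)
    (l_ge2 : (2 <= l)%N)
    (g_gen : (#|F|.-1).-primitive_root g) :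
  let K := powers F l in
  let k := #|K| in
  let q' := half_order F in
  let A := cyclotomic_matrix l g in
  let l_gt0 := ltnW l_ge2 in
  let B := reduced_cyclotomic_matrix g l_gt0 in
  let lambda : rat := (k%:R - 1) / l%:R in
  let S1 := is_difference_set K in
  let S2 := odd k /\
    exists2 j : int, coprimez j (Posz l) &
      (\sum_(i < l) cyclotomic_number l g (Posz i) j ^ 2)%N =
      (\sum_(i < l) cyclotomic_number l g (Posz i) (Posz q') ^ 2)%N in
  let S3 := odd k /\
    exists a b : rat, forall i : 'I_l,
      (A^T *m A) i i = if i == zero_index l_gt0 then a else b in
  [/\ (1 < k)%N -> (S1 <-> S2),
      S2 <-> S3
    & S1 \/ S2 \/ S3 ->
      A^T *m A = (lambda * k%:R) *: const_mx 1 + (k%:R - lambda) *: 1%:M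
                 - k%:R *: delta_mx (zero_index l_gt0) (zero_index l_gt0)
      /\ B^T *m B = (k%:R - lambda) *: (lambda *: const_mx 1 + 1%:M)].
Proof.
move=> K k q' A l_gt0 B lambda S1 S2 S3.
pose N := difference_count K K.
(* The pivot of all implications; unlike in S1, n may be 0, which happens for k = 1. *)
pose S0 := odd k /\ exists n, forall d, d != 0 -> N d = n.
have S10 : S1 -> S0.
  case/difference_set_powersP => mu _ Nmu.
  by split; [exact: (difference_const_odd l_dvd g_gen q_odd l_ge2 Nmu) | exists mu].
(* From k = n l + 1 > 1 comes n > 0, the positivity required of a difference set. *)
have S01 : (1 < k)%N -> S0 -> S1.
  move=> k_gt1 [k_odd [n Nn]]; apply/difference_set_powersP; exists n => //.
  have := difference_const_card l_dvd g_gen l_gt0 Nn; rewrite -/k.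
  by case: (n) => // e; move: k_gt1; rewrite -e.
have S20 : S2 -> S0.
  case=> k_odd [j co_jl eqj]; split=> //; exists (N 1).
  exact: (sum_sqr_cyclotomic_const l_dvd g_gen q_odd l_ge2 k_odd co_jl eqj).
have coprime1 : coprimez 1 l by rewrite /coprimez gcd1z.
have A_half :
    \sum_(i < l) (cyclotomic_number l g (Posz i) (Posz q') ^ 2)%N%:R =
    (A^T *m A) (half_index F l_gt0) (half_index F l_gt0).
  rewrite cyclotomic_gram_diag natr_sum; apply: eq_bigr => i _; congr (_ ^ 2)%N%:R.
  apply/esym/(cyclotomic_number_eq l_dvd g_gen); rewrite ?subrr ?dvdz0 //.
  exact: dvdz_subr_mod.
have S32 : S3 -> S2.
  (* The witness j = 1 works: 1 and q' are both nonzero modulo l, by l >= 2 and k odd, so both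
     diagonal entries equal b. *)
  case=> k_odd [a [b diag]]; split=> //; exists 1 => //.
  apply/eqP; rewrite -(eqr_nat rat) [X in _ == X]natr_sum A_half diag.
  rewrite (negbTE (half_index_neq0 l_dvd g_gen q_odd l_gt0 k_odd)).
  by have := diag (Ordinal l_ge2); rewrite cyclotomic_gram_diag => ->.
have S03 : S0 -> S3.
  case=> k_odd [n Nn]; split=> //.
  (* This is the value n k + (k - n) of [cyclotomic_gram_const] off the corner; the corner loses a
     further k. *)
  pose b : rat := n%:R * k%:R + (k%:R - n%:R).
  exists (b - k%:R), b => i.
  rewrite (cyclotomic_gram_const l_dvd g_gen l_gt0 Nn) !mxE eqxx !mulr1 -/k.
  by case: (i == _); rewrite ?mulr1 ?mulr0 ?subr0.
split.
- by move=> k_gt1; split=> [/S10/S03/S32|/S20/(S01 k_gt1)].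
- by split=> [/S20/S03|/S32].
move=> S; have [_ [n Nn]] : S0 by case: S => [/S10|[/S20|/S32/S20]].
(* The relation k = n l + 1 makes the quotient (k - 1) / l exact. *)
have -> : lambda = n%:R.
  have := difference_const_card l_dvd g_gen l_gt0 Nn; rewrite /lambda -/k => <-.
  by rewrite -addn1 natrD addrK natrM mulfK // pnatr_eq0 -lt0n.
split; first exact: cyclotomic_gram_const.
exact: reduced_cyclotomic_gram_const.
Qed.
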